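(* Let $\mathfrak{D}$ be the order-$8$ group generated by $\tau$ and $\iota$ acting on $R=\mathbb{C}[t_{(\pm1)},t_{(\pm2)},t_{(\pm3)},t_{(\pm4)}]$, let $P,Q\in R$ be the polynomials given in the context, and let $\mathbb{S}_{\mathfrak{D}}=\sum_{\sigma\in\mathfrak{D}}\sigma$ in the group ring $\mathbb{C}\mathfrak{D}$. Then $P=\mathbb{S}_{\mathfrak{D}}(p)-3$ and $Q=\mathbb{S}_{\mathfrak{D}}(q)+9$, where \begin{align*} p=&\tfrac{1}{8}\left(t_{(1)}t_{(-1)}t_{(2)}t_{(-2)}-4t_{(1)}t_{(-2)}t_{(-4)}+2t_{(1)}t_{(-1)}+2t_{(3)}t_{(-3)}\right),\\ q=&\tfrac{1}{8}\big(2t_{(-2)}t_{(-1)}^2t_{(1)}^2t_{(2)}+4t_{(1)}^2t_{(2)}^2t_{(3)}-4t_{(1)}^3t_{(-2)}t_{(2)}-8t_{(-4)}t_{(-2)}t_{(-1)}t_{(1)}^2\\ &-4t_{(4)}t_{(3)}t_{(2)}t_{(1)}t_{(-2)}+8t_{(1)}t_{(3)}t_{(-4)}^2+8t_{(-4)}t_{(1)}t_{(2)}^2 -8t_{(3)}^2t_{(2)}t_{(1)} +4t_{(4)}t_{(-3)}t_{(2)}^2\\ &+t_{(-2)}t_{(-1)}t_{(2)}t_{(1)}+t_{(-3)}t_{(-4)}t_{(3)}t_{(4)} +4t_{(-3)}t_{(-1)}t_{(3)}t_{(1)} +4t_{(1)}^3 +4t_{(3)}^3\\ &+12t_{(-4)}t_{(-2)}t_{(1)}-12t_{(-4)}t_{(2)}t_{(3)}-12t_{(1)}t_{(-1)}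 -12t_{(3)}t_{(-3)}\big). \end{align*}
   Context: $\mathfrak{D}$ is the subgroup of $\mathrm{Out}(F_2)$ ($F_2$ free on $\mathtt{x}_1,\mathtt{x}_2$) generated by $\tau:\mathtt{x}_1\leftrightarrow\mathtt{x}_2$ and $\iota:\mathtt{x}_1\mapsto\mathtt{x}_1^{-1},\ \mathtt{x}_2\mapsto\mathtt{x}_2$. It acts on $\mathbb{C}[\mathrm{SL}(3,\mathbb{C})^2]^{\mathrm{SL}(3,\mathbb{C})}$ by algebra automorphisms with $\mathrm{tr}(\mathbf{w})\mapsto\mathrm{tr}(\alpha(\mathbf{w}))$ for words $\mathbf{w}$ in generic unimodular matrices $\mathbf{x}_1,\mathbf{x}_2$. With $t_{(1)}=\mathrm{tr}(\mathbf{x}_1)$, $t_{(-1)}=\mathrm{tr}(\mathbf{x}_1^{-1})$, $t_{(2)}=\mathrm{tr}(\mathbf{x}_2)$, $t_{(-2)}=\mathrm{tr}(\mathbf{x}_2^{-1})$, $t_{(3)}=\mathrm{tr}(\mathbf{x}_1\mathbf{x}_2)$, $t_{(-3)}=\mathrm{tr}(\mathbf{x}_1^{-1}\mathbf{x}_2^{-1})$, $t_{(4)}=\mathrm{tr}(\mathbf{x}_1\mathbf{x}_2^{-1})$, $t_{(-4)}=\mathrm{tr}(\mathbf{x}_1^{-1}\mathbf{x}_2)$ (algebraically independent, generating the polynomial ring $R$), the action on $R$ permutes the variables' indices: $\tau$ acts as $(1,2)(-1,-2)(4,-4)$ and $\iota$ as $(1,-1)(3,-4)(-3,4)$; $\mathfrak{D}$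 acts on $R$ faithfully as a group of order $8$. The polynomials are $$P=t_{(1)}t_{(-1)}t_{(2)}t_{(-2)}-t_{(1)}t_{(2)}t_{(-3)}-t_{(-1)}t_{(-2)}t_{(3)}-t_{(1)}t_{(-2)}t_{(-4)}-t_{(-1)}t_{(2)}t_{(4)}+t_{(1)}t_{(-1)}+t_{(2)}t_{(-2)}+t_{(3)}t_{(-3)}+t_{(4)}t_{(-4)}-3$$ and \begin{align*} Q=&\,9-6t_{(1)}t_{(-1)} -6t_{(2)}t_{(-2)} -6t_{(3)}t_{(-3)} -6t_{(4)}t_{(-4)}+t_{(1)}^3 +t_{(2)}^3 +t_{(3)}^3\\ &+t_{(4)}^3 +t_{(-1)}^3 + t_{(-2)}^3 +t_{(-3)}^3 +t_{(-4)}^3 -3t_{(-4)}t_{(-3)}t_{(-1)} -3t_{(4)}t_{(3)}t_{(1)}\\ &-3t_{(-4)}t_{(2)}t_{(3)} -3t_{(4)}t_{(-2)}t_{(-3)}+3t_{(-4)}t_{(-2)}t_{(1)} +3t_{(4)}t_{(2)}t_{(-1)}\\ &+ 3t_{(1)}t_{(2)}t_{(-3)} +3t_{(-1)}t_{(-2)}t_{(3)}+t_{(-2)}t_{(-1)}t_{(2)}t_{(1)}+t_{(-3)}t_{(-2)}t_{(3)}t_{(2)}\\ &+t_{(-4)}t_{(-1)}t_{(4)}t_{(1)} +t_{(-4)}t_{(-2)}t_{(4)}t_{(2)} +t_{(-3)}t_{(-1)}t_{(3)}t_{(1)}+t_{(-3)}t_{(-4)}t_{(3)}t_{(4)}\\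 &+t_{(-4)}^2t_{(-3)}t_{(-2)} +t_{(4)}^2t_{(3)}t_{(2)} +t_{(-1)}^2t_{(-2)}t_{(-4)} +t_{(1)}^2t_{(2)}t_{(4)}+t_{(1)}t_{(-2)}^2t_{(-3)}\\ &+t_{(-1)}t_{(2)}^2t_{(3)} +t_{(-4)}t_{(-3)}t_{(1)}^2 +t_{(4)}t_{(3)}t_{(-1)}^2 +t_{(-4)}t_{(2)}t_{(-3)}^2 +t_{(4)}t_{(-2)}t_{(3)}^2 \\ &+t_{(-1)}^2t_{(-3)}t_{(2)} +t_{(1)}^2t_{(3)}t_{(-2)} +t_{(-4)}t_{(1)}t_{(2)}^2 +t_{(4)}t_{(-1)}t_{(-2)}^2+t_{(-4)}t_{(3)}t_{(-2)}^2\\ &+t_{(4)}t_{(-3)}t_{(2)}^2 +t_{(1)}t_{(3)}t_{(-4)}^2 +t_{(-1)}t_{(-3)}t_{(4)}^2 +t_{(-1)}t_{(-4)}t_{(3)}^2\\ &+t_{(1)}t_{(4)}t_{(-3)}^2-2t_{(-3)}^2t_{(-2)}t_{(-1)}-2t_{(3)}^2t_{(2)}t_{(1)} -2t_{(-4)}^2t_{(-1)}t_{(2)}\\ &-2t_{(4)}^2t_{(1)}t_{(-2)}+t_{(-1)}^2t_{(-2)}^2t_{(-3)}+t_{(1)}^2t_{(2)}^2t_{(3)}+t_{(-4)}t_{(-1)}^2t_{(2)}^2\\ &+t_{(4)}t_{(1)}^2t_{(-2)}^2-t_{(-4)}t_{(-2)}^2t_{(2)}t_{(1)} -t_{(4)}t_{(2)}^2t_{(-2)}t_{(-1)}\\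 &-t_{(-3)}t_{(1)}^2t_{(-1)}t_{(2)}-t_{(3)}t_{(-1)}^2t_{(1)}t_{(-2)}-t_{(-3)}t_{(2)}^2t_{(-2)}t_{(1)} -t_{(3)}t_{(-2)}^2t_{(2)}t_{(-1)}\\ &-t_{(-4)}t_{(-2)}t_{(-1)}t_{(1)}^2 -t_{(4)}t_{(2)}t_{(1)}t_{(-1)}^2-t_{(-1)}t_{(-2)}^3t_{(1)}-t_{(-1)}t_{(2)}^3t_{(1)} \\ &-t_{(-1)}^3t_{(-2)}t_{(2)}-t_{(1)}^3t_{(-2)}t_{(2)}-t_{(-4)}t_{(-3)}t_{(-2)}t_{(-1)}t_{(2)}-t_{(4)}t_{(3)}t_{(2)}t_{(1)}t_{(-2)}\\ &-t_{(-1)}t_{(1)}t_{(2)}t_{(-4)}t_{(3)} -t_{(-1)}t_{(1)}t_{(-2)}t_{(4)}t_{(-3)}+ t_{(-2)}t_{(-1)}^2t_{(1)}^2t_{(2)} +t_{(-1)}t_{(-2)}^2t_{(2)}^2t_{(1)}. \end{align*} *)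

(* Defs.v *)
From HB Require Import structures.
From mathcomp Require Import all_boot all_order all_fingroup all_algebra
  all_solvable.
From mathcomp Require Import reals.
From mathcomp Require Import complex.
From mathcomp Require Import mpoly.

Set Implicit Arguments.
Unset Strict Implicit.
Unset Printing Implicit Defensive.

Import Order.TTheory GRing.Theory Num.Theory.
Local Open Scope ring_scope.

(* The labels 1, 2, 3, 4, -1, -2, -3, -4 of the variables are numbered        *)
(* 0, 1, ..., 7 in this order; no other label is ever used.                   *)
Definition lab (k : int) : 'I_8 :=
  inord (match k with Posz n => n.-1 | Negz n => (4 + n)%N end).
Arguments lab k%_Z.

(* The automorphisms x_1 <-> x_2 and x_1 |-> x_1^-1 of the free group, given  *)
(* by the permutations of labels through which they act; mevalt_tau and       *)
(* mevalt_iota below check these permutations on traces.                      *)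
Definition tau : 'S_8 :=
  (tperm (lab 1) (lab 2) * tperm (lab (-1)) (lab (-2))
   * tperm (lab 4) (lab (-4)))%g.

Definition iota_ : 'S_8 :=
  (tperm (lab 1) (lab (-1)) * tperm (lab 3) (lab (-4))
   * tperm (lab (-3)) (lab 4))%g.

(* The subgroup of Out(F_2) generated by these automorphisms acts faithfully  *)
(* on polynomials, so it is identified with its image in the permutations of  *)
(* the labels; see card_frakD for its order.                                  *)
Definition frakD : {group 'S_8} := <<[set tau; iota_]>>%G.

Section Ring.
Variable R : realType.
(* The complex numbers.                                                       *)
Notation C := R[i].

Definition t (k : int) : {mpoly C[8]} := 'X_(lab k).
Arguments t k%_Z.

(* The action of the group ring element \sum_(s in frakD) s on polynomials.   *)
(* msym s is the C-algebra automorphism sending 'X_i to 'X_(s i).  Products   *)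
(* of permutations compose left to right, so this is a right action, which    *)
(* does not affect the sum over the whole group.                              *)
Definition symD (r : {mpoly C[8]}) : {mpoly C[8]} :=
  \sum_(s in frakD) msym s r.

Definition traceP : {mpoly C[8]} :=
    t 1 * t (-1) * t 2 * t (-2) - t 1 * t 2 * t (-3) - t (-1) * t (-2) * t 3
    - t 1 * t (-2) * t (-4) - t (-1) * t 2 * t 4 + t 1 * t (-1) + t 2 * t (-2)
    + t 3 * t (-3) + t 4 * t (-4) - 3.

Definition traceQ : {mpoly C[8]} :=
    9 - 6 * t 1 * t (-1) - 6 * t 2 * t (-2) - 6 * t 3 * t (-3)
    - 6 * t 4 * t (-4) + t 1 ^+ 3 + t 2 ^+ 3 + t 3 ^+ 3 + t 4 ^+ 3
    + t (-1) ^+ 3 + t (-2) ^+ 3 + t (-3) ^+ 3 + t (-4) ^+ 3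
    - 3 * t (-4) * t (-3) * t (-1) - 3 * t 4 * t 3 * t 1
    - 3 * t (-4) * t 2 * t 3 - 3 * t 4 * t (-2) * t (-3)
    + 3 * t (-4) * t (-2) * t 1 + 3 * t 4 * t 2 * t (-1)
    + 3 * t 1 * t 2 * t (-3) + 3 * t (-1) * t (-2) * t 3
    + t (-2) * t (-1) * t 2 * t 1 + t (-3) * t (-2) * t 3 * t 2
    + t (-4) * t (-1) * t 4 * t 1 + t (-4) * t (-2) * t 4 * t 2
    + t (-3) * t (-1) * t 3 * t 1 + t (-3) * t (-4) * t 3 * t 4
    + t (-4) ^+ 2 * t (-3) * t (-2) + t 4 ^+ 2 * t 3 * t 2
    + t (-1) ^+ 2 * t (-2) * t (-4) + t 1 ^+ 2 * t 2 * t 4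
    + t 1 * t (-2) ^+ 2 * t (-3) + t (-1) * t 2 ^+ 2 * t 3
    + t (-4) * t (-3) * t 1 ^+ 2 + t 4 * t 3 * t (-1) ^+ 2
    + t (-4) * t 2 * t (-3) ^+ 2 + t 4 * t (-2) * t 3 ^+ 2
    + t (-1) ^+ 2 * t (-3) * t 2 + t 1 ^+ 2 * t 3 * t (-2)
    + t (-4) * t 1 * t 2 ^+ 2 + t 4 * t (-1) * t (-2) ^+ 2
    + t (-4) * t 3 * t (-2) ^+ 2 + t 4 * t (-3) * t 2 ^+ 2
    + t 1 * t 3 * t (-4) ^+ 2 + t (-1) * t (-3) * t 4 ^+ 2
    + t (-1) * t (-4) * t 3 ^+ 2 + t 1 * t 4 * t (-3) ^+ 2
    - 2 * t (-3) ^+ 2 * t (-2) * t (-1) - 2 * t 3 ^+ 2 * t 2 * t 1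
    - 2 * t (-4) ^+ 2 * t (-1) * t 2 - 2 * t 4 ^+ 2 * t 1 * t (-2)
    + t (-1) ^+ 2 * t (-2) ^+ 2 * t (-3) + t 1 ^+ 2 * t 2 ^+ 2 * t 3
    + t (-4) * t (-1) ^+ 2 * t 2 ^+ 2 + t 4 * t 1 ^+ 2 * t (-2) ^+ 2
    - t (-4) * t (-2) ^+ 2 * t 2 * t 1 - t 4 * t 2 ^+ 2 * t (-2) * t (-1)
    - t (-3) * t 1 ^+ 2 * t (-1) * t 2 - t 3 * t (-1) ^+ 2 * t 1 * t (-2)
    - t (-3) * t 2 ^+ 2 * t (-2) * t 1 - t 3 * t (-2) ^+ 2 * t 2 * t (-1)
    - t (-4) * t (-2) * t (-1) * t 1 ^+ 2 - t 4 * t 2 * t 1 * t (-1) ^+ 2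
    - t (-1) * t (-2) ^+ 3 * t 1 - t (-1) * t 2 ^+ 3 * t 1
    - t (-1) ^+ 3 * t (-2) * t 2 - t 1 ^+ 3 * t (-2) * t 2
    - t (-4) * t (-3) * t (-2) * t (-1) * t 2 - t 4 * t 3 * t 2 * t 1 * t (-2)
    - t (-1) * t 1 * t 2 * t (-4) * t 3 - t (-1) * t 1 * t (-2) * t 4 * t (-3)
    + t (-2) * t (-1) ^+ 2 * t 1 ^+ 2 * t 2
    + t (-1) * t (-2) ^+ 2 * t 2 ^+ 2 * t 1.

Definition seedp : {mpoly C[8]} :=
  (8^-1 : C) *: (
    t 1 * t (-1) * t 2 * t (-2) - 4 * t 1 * t (-2) * t (-4) + 2 * t 1 * t (-1)
    + 2 * t 3 * t (-3)).

Definition seedq : {mpoly C[8]} :=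
  (8^-1 : C) *: (
    2 * t (-2) * t (-1) ^+ 2 * t 1 ^+ 2 * t 2 + 4 * t 1 ^+ 2 * t 2 ^+ 2 * t 3
    - 4 * t 1 ^+ 3 * t (-2) * t 2 - 8 * t (-4) * t (-2) * t (-1) * t 1 ^+ 2
    - 4 * t 4 * t 3 * t 2 * t 1 * t (-2) + 8 * t 1 * t 3 * t (-4) ^+ 2
    + 8 * t (-4) * t 1 * t 2 ^+ 2 - 8 * t 3 ^+ 2 * t 2 * t 1
    + 4 * t 4 * t (-3) * t 2 ^+ 2 + t (-2) * t (-1) * t 2 * t 1
    + t (-3) * t (-4) * t 3 * t 4 + 4 * t (-3) * t (-1) * t 3 * t 1
    + 4 * t 1 ^+ 3 + 4 * t 3 ^+ 3 + 12 * t (-4) * t (-2) * t 1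
    - 12 * t (-4) * t 2 * t 3 - 12 * t 1 * t (-1) - 12 * t 3 * t (-3)).

End Ring.
Arguments t {R} k%_Z.
Arguments symD {R} r.

Section Check.

Let lab_val k : (`|k| <= 4)%N -> k != 0 ->
  lab k = (match k with Posz n => n.-1 | Negz n => (4 + n)%N end) :> nat.
Proof.
by case: k => [[|[|[|[|[|n]]]]]|[|[|[|[|n]]]]] //= _ _; rewrite inordK.
Qed.

Let val_tperm (a b i : 'I_8) :
  tperm a b i = (if i == a :> nat then b : nat else
                 if i == b :> nat then a : nat else i : nat) :> nat.
Proof. by rewrite permE /= -!val_eqE /=; do 2?case: ifP. Qed.

Let tauE i : tau i = nth 0 [:: 1; 0; 2; 7; 5; 4; 6; 3]%N i :> nat.
Proof.
rewrite !permM !val_tperm !lab_val //.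
by case: i => [[|[|[|[|[|[|[|[|]]]]]]]] i8].
Qed.

Let iotaE i : iota_ i = nth 0 [:: 4; 1; 7; 6; 0; 5; 3; 2]%N i :> nat.
Proof.
rewrite !permM !val_tperm !lab_val //.
by case: i => [[|[|[|[|[|[|[|[|]]]]]]]] i8].
Qed.

Lemma card_frakD : #|frakD| = 8%N.
Proof.
rewrite /frakD; move: tau iota_ tauE iotaE => a b aE bE.
have o2 (x : 'S_8) : x != 1%g -> (forall i, x (x i) = i) -> #[x]%g = 2%N.
  move=> x1 xK; apply: nt_prime_order => //.
  by apply/permP => i; rewrite expgS expg1 permM perm1 xK.
have a2 : #[a]%g = 2%N.
  apply: o2.
    by apply/eqP=> /permP/(_ ord0)/(congr1 val) /=; rewrite aE perm1.
  move=> i; apply: val_inj; rewrite /= !aE.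
  by case: i => [[|[|[|[|[|[|[|[|]]]]]]]] i8].
have b2 : #[b]%g = 2%N.
  apply: o2.
    by apply/eqP=> /permP/(_ ord0)/(congr1 val) /=; rewrite bE perm1.
  move=> i; apply: val_inj; rewrite /= !bE.
  by case: i => [[|[|[|[|[|[|[|[|]]]]]]]] i8].
have d4 : (#[a * b]%g %| 2 ^ 2)%N.
  rewrite order_dvdn; apply/eqP/permP => i; apply: val_inj.
  rewrite !expgS expg0 !permM !perm1 /= !(bE, aE).
  by case: i => [[|[|[|[|[|[|[|[|]]]]]]]] i8].
have n2 : ~~ (#[a * b]%g %| 2 ^ 1)%N.
  rewrite order_dvdn; apply/eqP => /permP/(_ ord0)/(congr1 val) /=.
  by rewrite !expgS expg0 !permM !perm1 /= !(bE, aE).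
have /(dvdn_pfactor _ _ (isT : prime 2)) [k k2 ek] := d4.
have o4 : #[a * b]%g = 4%N.
  by move: n2; rewrite ek; case: k k2 {ek} => [|[|[|]]].
have aK : (a * a = 1)%g by rewrite -(expg_order a) a2 expgS expg1.
have bK : (b * b = 1)%g by rewrite -(expg_order b) b2 expgS expg1.
have aV : (a^-1 = a)%g by apply/eqP; rewrite eq_invg_mul aK.
have bV : (b^-1 = b)%g by apply/eqP; rewrite eq_invg_mul bK.
have nz : (<[a]> \subset 'N(<[a * b]>))%g.
  rewrite cycle_subG; apply/normP; rewrite -cycleJ conjgE aV !mulgA aK mul1g.
  by rewrite -[(b * a)%g]invgK invMg bV aV cycleV.
have ti : (<[a * b]> :&: <[a]> = 1)%g.
  rewrite setIC prime_TIg -?orderE ?a2 // cycle_subG.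
  apply/negP => /cyclePmin[j]; rewrite o4.
  case: j => [|[|[|[|//]]]] _ /permP e;
    move: (congr1 val (e (inord 0))) (congr1 val (e (inord 2)));
    by rewrite ?(expgS, expg0, mulg1, permM, perm1) /= !(bE, aE) !inordK.
suff -> : <<[set a; b]>>%G = (<[a * b]> <*> <[a]>)%G.
  by rewrite /= norm_joinEr // TI_cardMg // -!orderE o4 a2.
apply/val_inj/eqP; rewrite /= eqEsubset !gen_subG !subUset.
rewrite !gen_subG !sub1set /=.
have a_in : a \in (<[a * b]> <*> <[a]>)%g.
  by rewrite mem_gen // inE cycle_id orbT.
rewrite a_in -(groupMl b a_in); apply/and3P; split.
- by rewrite mem_gen // inE cycle_id.
- by rewrite groupM ?mem_gen ?set21 ?set22.
- by rewrite mem_gen ?set21.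
Qed.

Variable R : realType.
Notation C := R[i].

(* The values of the variables at a pair (A, B) of unimodular matrices.       *)
Definition trcoord (A B : 'M[C]_3) (i : 'I_8) : C :=
  nth 0 [:: \tr A; \tr B; \tr (A *m B); \tr (A *m invmx B);
            \tr (invmx A); \tr (invmx B); \tr (invmx A *m invmx B);
            \tr (invmx A *m B)] i.

Let meval_msym (s : 'S_8) (r : {mpoly C[8]}) (v : 'I_8 -> C) :
  (msym s r).@[v] = r.@[fun i => v (s i)].
Proof.
elim/mpolyind: r => [|c m p _ _ IH]; first by rewrite msym0 !meval0.
rewrite msymD !mevalD IH msymZ !mevalZ; congr (_ * _ + _).
rewrite msymX !mevalX (reindex_inj (@perm_inj _ s)) /=.
by apply: eq_bigr => i _; rewrite mnmE permK.
Qed.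

Lemma mevalt_tau (A B : 'M[C]_3) (r : {mpoly C[8]}) :
  (msym tau r).@[trcoord A B] = r.@[trcoord B A].
Proof.
rewrite meval_msym; apply: meval_eq => i; rewrite /trcoord tauE.
by case: i => [[|[|[|[|[|[|[|[|]]]]]]]] i8] //=; rewrite mxtrace_mulC.
Qed.

Lemma mevalt_iota (A B : 'M[C]_3) (r : {mpoly C[8]}) :
  (msym iota_ r).@[trcoord A B] = r.@[trcoord (invmx A) B].
Proof.
rewrite meval_msym; apply: meval_eq => i; rewrite /trcoord iotaE.
by case: i => [[|[|[|[|[|[|[|[|]]]]]]]] i8] //=; rewrite invmxK.
Qed.

End Check.

(* Main.v *)
Require Import Defs.
From HB Require Import structures.
From mathcomp Require Import all_boot all_order all_fingroup all_algebra.
From mathcomp Require Import reals.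
From mathcomp Require Import complex.
From mathcomp Require Import mpoly.
From mathcomp Require Import ring.

Import Order.TTheory GRing.Theory Num.Theory.
Local Open Scope ring_scope.

(* The eight elements of frakD are explicit words in tau and iota_, listed    *)
(* completely because card_frakD gives the order; summing the images of the   *)
(* seeds over these words leaves an identity between explicit polynomials.    *)

(** The nonconstant monomials of [traceP] and [traceQ] fall into orbits of [frakD], with a constant
    coefficient c on each orbit. A seed keeps one representative m per orbit, with coefficient c
    |orbit of m| / 8. Summing over the group hits each monomial of the orbit |Stab m| times, and
    |orbit| |Stab| = 8, so c is recovered. [symDE] turns the sum over the group into the sum
    [orbit_sum] over eight words; [orbit_sum_seedp8] and [orbit_sum_seedq8] verify the resulting
    identities, and [symD_scale8] restores the factor 1/8. *)

Definition is_label (k : int) : bool := (`|k| <= 4)%N && (k != 0).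

(** The range matters: [lab 0] collides with [lab 1], and [lab 5] with [lab (-1)]. *)
Lemma eq_lab (k l : int) :
  is_label k -> is_label l -> (lab k == lab l) = (k == l).
Proof.
by case: k l => [[|[|[|[|[|?]]]]]|[|[|[|[|?]]]]] [[|[|[|[|[|?]]]]]|[|[|[|[|?]]]]]
  // _ _; rewrite -val_eqE /= !inordK.
Qed.

Lemma tau_lab :
  (tau (lab 1) = lab 2) * (tau (lab 2) = lab 1) *
  (tau (lab 3) = lab 3) * (tau (lab 4) = lab (-4)) *
  (tau (lab (-1)) = lab (-2)) * (tau (lab (-2)) = lab (-1)) *
  (tau (lab (-3)) = lab (-3)) * (tau (lab (-4)) = lab 4).
Proof. by do !split; rewrite !permM; do 3 rewrite permE /= ?eq_lab //=. Qed.

Lemma iota_lab :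
  (iota_ (lab 1) = lab (-1)) * (iota_ (lab 2) = lab 2) *
  (iota_ (lab 3) = lab (-4)) * (iota_ (lab 4) = lab (-3)) *
  (iota_ (lab (-1)) = lab 1) * (iota_ (lab (-2)) = lab (-2)) *
  (iota_ (lab (-3)) = lab 4) * (iota_ (lab (-4)) = lab 3).
Proof. by do !split; rewrite !permM; do 3 rewrite permE /= ?eq_lab //=. Qed.

Definition frakD_elements : seq 'S_8 :=
  [:: 1; tau; iota_; tau * iota_; iota_ * tau; tau * iota_ * tau;
      iota_ * tau * iota_; tau * iota_ * tau * iota_]%g.

Lemma uniq_frakD_elements : uniq frakD_elements.
Proof.
(* Abstract tau and iota_, which are products that permM would also unfold. *)
rewrite /frakD_elements; move: tau iota_ tau_lab iota_lab => a b aE bE.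
(* The group acts faithfully by signed permutations of 1 and 2, so the images of these two labels
   already separate the words. *)
apply: (@map_uniq _ _ (fun s : 'S_8 => (s (lab 1), s (lab 2)))).
by rewrite /= !permM !perm1 !(aE, bE) !inE !xpair_eqE !eq_lab.
Qed.

Lemma perm_enum_frakD : perm_eq (enum frakD) frakD_elements.
Proof.
have tauD : tau \in frakD by rewrite mem_gen // set21.
have iotaD : iota_ \in frakD by rewrite mem_gen // set22.
have subD : {subset frakD_elements <= enum frakD}.
  apply/allP; rewrite /= !mem_enum /=.
  by rewrite ?(group1, tauD, iotaD, groupM).
have [|_ eqD] := uniq_min_size uniq_frakD_elements subD.
  by rewrite -cardE card_frakD.
by apply: uniq_perm (enum_uniq _) uniq_frakD_elements _ => s; rewrite eqD.
Qed.

Section CommutativeRing.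
Variable A : comNzRingType.

(* The trace polynomials and 8 times the seeds, over an abstract ring: there  *)
(* rewriting with morphisms is fast, while in {mpoly C[8]} unification        *)
(* unfolds the concrete operations and hardly terminates.                     *)
Section Formulas.
Variable x : int -> A.
Arguments x _%_Z.

Definition traceP_at : A :=
  x 1 * x (-1) * x 2 * x (-2) - x 1 * x 2 * x (-3) - x (-1) * x (-2) * x 3
  - x 1 * x (-2) * x (-4) - x (-1) * x 2 * x 4 + x 1 * x (-1) + x 2 * x (-2)
  + x 3 * x (-3) + x 4 * x (-4) - 3.

Definition traceQ_at : A :=
  9 - 6 * x 1 * x (-1) - 6 * x 2 * x (-2) - 6 * x 3 * x (-3)
  - 6 * x 4 * x (-4) + x 1 ^+ 3 + x 2 ^+ 3 + x 3 ^+ 3 + x 4 ^+ 3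
  + x (-1) ^+ 3 + x (-2) ^+ 3 + x (-3) ^+ 3 + x (-4) ^+ 3
  - 3 * x (-4) * x (-3) * x (-1) - 3 * x 4 * x 3 * x 1
  - 3 * x (-4) * x 2 * x 3 - 3 * x 4 * x (-2) * x (-3)
  + 3 * x (-4) * x (-2) * x 1 + 3 * x 4 * x 2 * x (-1)
  + 3 * x 1 * x 2 * x (-3) + 3 * x (-1) * x (-2) * x 3
  + x (-2) * x (-1) * x 2 * x 1 + x (-3) * x (-2) * x 3 * x 2
  + x (-4) * x (-1) * x 4 * x 1 + x (-4) * x (-2) * x 4 * x 2
  + x (-3) * x (-1) * x 3 * x 1 + x (-3) * x (-4) * x 3 * x 4
  + x (-4) ^+ 2 * x (-3) * x (-2) + x 4 ^+ 2 * x 3 * x 2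
  + x (-1) ^+ 2 * x (-2) * x (-4) + x 1 ^+ 2 * x 2 * x 4
  + x 1 * x (-2) ^+ 2 * x (-3) + x (-1) * x 2 ^+ 2 * x 3
  + x (-4) * x (-3) * x 1 ^+ 2 + x 4 * x 3 * x (-1) ^+ 2
  + x (-4) * x 2 * x (-3) ^+ 2 + x 4 * x (-2) * x 3 ^+ 2
  + x (-1) ^+ 2 * x (-3) * x 2 + x 1 ^+ 2 * x 3 * x (-2)
  + x (-4) * x 1 * x 2 ^+ 2 + x 4 * x (-1) * x (-2) ^+ 2
  + x (-4) * x 3 * x (-2) ^+ 2 + x 4 * x (-3) * x 2 ^+ 2
  + x 1 * x 3 * x (-4) ^+ 2 + x (-1) * x (-3) * x 4 ^+ 2
  + x (-1) * x (-4) * x 3 ^+ 2 + x 1 * x 4 * x (-3) ^+ 2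
  - 2 * x (-3) ^+ 2 * x (-2) * x (-1) - 2 * x 3 ^+ 2 * x 2 * x 1
  - 2 * x (-4) ^+ 2 * x (-1) * x 2 - 2 * x 4 ^+ 2 * x 1 * x (-2)
  + x (-1) ^+ 2 * x (-2) ^+ 2 * x (-3) + x 1 ^+ 2 * x 2 ^+ 2 * x 3
  + x (-4) * x (-1) ^+ 2 * x 2 ^+ 2 + x 4 * x 1 ^+ 2 * x (-2) ^+ 2
  - x (-4) * x (-2) ^+ 2 * x 2 * x 1 - x 4 * x 2 ^+ 2 * x (-2) * x (-1)
  - x (-3) * x 1 ^+ 2 * x (-1) * x 2 - x 3 * x (-1) ^+ 2 * x 1 * x (-2)
  - x (-3) * x 2 ^+ 2 * x (-2) * x 1 - x 3 * x (-2) ^+ 2 * x 2 * x (-1)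
  - x (-4) * x (-2) * x (-1) * x 1 ^+ 2 - x 4 * x 2 * x 1 * x (-1) ^+ 2
  - x (-1) * x (-2) ^+ 3 * x 1 - x (-1) * x 2 ^+ 3 * x 1
  - x (-1) ^+ 3 * x (-2) * x 2 - x 1 ^+ 3 * x (-2) * x 2
  - x (-4) * x (-3) * x (-2) * x (-1) * x 2 - x 4 * x 3 * x 2 * x 1 * x (-2)
  - x (-1) * x 1 * x 2 * x (-4) * x 3 - x (-1) * x 1 * x (-2) * x 4 * x (-3)
  + x (-2) * x (-1) ^+ 2 * x 1 ^+ 2 * x 2
  + x (-1) * x (-2) ^+ 2 * x 2 ^+ 2 * x 1.

Definition seedp8_at : A :=
  x 1 * x (-1) * x 2 * x (-2) - 4 * x 1 * x (-2) * x (-4) + 2 * x 1 * x (-1)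
  + 2 * x 3 * x (-3).

Definition seedq8_at : A :=
  2 * x (-2) * x (-1) ^+ 2 * x 1 ^+ 2 * x 2 + 4 * x 1 ^+ 2 * x 2 ^+ 2 * x 3
  - 4 * x 1 ^+ 3 * x (-2) * x 2 - 8 * x (-4) * x (-2) * x (-1) * x 1 ^+ 2
  - 4 * x 4 * x 3 * x 2 * x 1 * x (-2) + 8 * x 1 * x 3 * x (-4) ^+ 2
  + 8 * x (-4) * x 1 * x 2 ^+ 2 - 8 * x 3 ^+ 2 * x 2 * x 1
  + 4 * x 4 * x (-3) * x 2 ^+ 2 + x (-2) * x (-1) * x 2 * x 1
  + x (-3) * x (-4) * x 3 * x 4 + 4 * x (-3) * x (-1) * x 3 * x 1
  + 4 * x 1 ^+ 3 + 4 * x 3 ^+ 3 + 12 * x (-4) * x (-2) * x 1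
  - 12 * x (-4) * x 2 * x 3 - 12 * x 1 * x (-1) - 12 * x 3 * x (-3).

End Formulas.

Lemma rmorph_seedp8_at (f : {rmorphism A -> A}) (x : int -> A) :
  f (seedp8_at x) = seedp8_at (f \o x).
Proof.
by rewrite /seedp8_at !(rmorph_nat, rmorphXn, rmorphM, rmorphB, rmorphD).
Qed.

Lemma rmorph_seedq8_at (f : {rmorphism A -> A}) (x : int -> A) :
  f (seedq8_at x) = seedq8_at (f \o x).
Proof.
by rewrite /seedq8_at !(rmorph_nat, rmorphXn, rmorphM, rmorphB, rmorphD).
Qed.

Variables (a b : {rmorphism A -> A}) (x : int -> A).
Arguments x _%_Z.

(** The terms follow [frakD_elements]; the left factor of a word acts first, so [tau * iota_] gives
    [b (a r)]. An orbit element recurs once per element of the stabilizer. *)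
Definition orbit_sum (r : A) : A :=
  r + (a r + (b r + (b (a r) + (a (b r) + (a (b (a r)) +
  (b (a (b r)) + b (a (b (a r))))))))).

Hypothesis aE :
  (a (x 1) = x 2) * (a (x 2) = x 1) * (a (x 3) = x 3) * (a (x 4) = x (-4)) *
  (a (x (-1)) = x (-2)) * (a (x (-2)) = x (-1)) *
  (a (x (-3)) = x (-3)) * (a (x (-4)) = x 4).

Hypothesis bE :
  (b (x 1) = x (-1)) * (b (x 2) = x 2) * (b (x 3) = x (-4)) *
  (b (x 4) = x (-3)) * (b (x (-1)) = x 1) * (b (x (-2)) = x (-2)) *
  (b (x (-3)) = x 4) * (b (x (-4)) = x 3).

Lemma orbit_sum_seedp8 : orbit_sum (seedp8_at x) = 8 * (traceP_at x + 3).
Proof.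
rewrite /orbit_sum !rmorph_seedp8_at /seedp8_at /= !(aE, bE) /traceP_at.
ring.
Qed.

Lemma orbit_sum_seedq8 : orbit_sum (seedq8_at x) = 8 * (traceQ_at x - 9).
Proof.
rewrite /orbit_sum !rmorph_seedq8_at /seedq8_at /= !(aE, bE) /traceQ_at.
ring.
Qed.

End CommutativeRing.

Section SymmetrizerD.
Variable R : realType.
Notation C := R[i].

Lemma symDE (r : {mpoly C[8]}) :
  symD r = orbit_sum _ (msym tau) (msym iota_) r.
Proof.
rewrite /symD -big_enum (perm_big _ perm_enum_frakD) /frakD_elements.
rewrite /orbit_sum; move: tau iota_ => a b /=.
by rewrite 7!big_cons big_seq1 !msymMm msym1m.
Qed.

Lemma symDZ (c : C) (r : {mpoly C[8]}) : symD (c *: r) = c *: symD r.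
Proof. by rewrite /symD scaler_sumr; apply: eq_bigr => s _; rewrite msymZ. Qed.

Lemma msym_t (s : 'S_8) (k : int) :
  msym s (t k) = 'X_(s (lab k)) :> {mpoly C[8]}.
Proof.
rewrite msymX; congr 'X_[_]; apply/mnmP => i.
(* Renaming variables by [s] permutes exponents by its inverse. *)
by rewrite mnmE !mnm1E (can2_eq (permK s) (permKV s)).
Qed.

Lemma msym_tau_t :
  let a := msym (R := C) tau in
  (a (t 1) = t 2) * (a (t 2) = t 1) * (a (t 3) = t 3) * (a (t 4) = t (-4)) *
  (a (t (-1)) = t (-2)) * (a (t (-2)) = t (-1)) *
  (a (t (-3)) = t (-3)) * (a (t (-4)) = t 4).
Proof. by rewrite /= !msym_t !tau_lab. Qed.

Lemma msym_iota_t :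
  let b := msym (R := C) iota_ in
  (b (t 1) = t (-1)) * (b (t 2) = t 2) * (b (t 3) = t (-4)) *
  (b (t 4) = t (-3)) * (b (t (-1)) = t 1) * (b (t (-2)) = t (-2)) *
  (b (t (-3)) = t 4) * (b (t (-4)) = t 3).
Proof. by rewrite /= !msym_t !iota_lab. Qed.

(** The identities over an abstract ring have integer coefficients; the division by 8 is made here,
    in characteristic zero. *)
Lemma symD_scale8 (r s : {mpoly C[8]}) :
  symD r = 8 * s -> symD ((8^-1 : C) *: r) = s.
Proof.
move=> rs; rewrite symDZ rs mulr_natl -scalerMnr scalerMnl -mulr_natr.
by rewrite mulVf ?scale1r // pnatr_eq0.
Qed.

End SymmetrizerD.

Theorem corollary15 (R : realType) :
  traceP R = symD (seedp R) - 3 /\ traceQ R = symD (seedq R) + 9.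
Proof.
have [aE bE] := (msym_tau_t R, msym_iota_t R).
split.
(* The seed has no constant term, so it symmetrizes to [traceP] with its constant -3 removed. *)
- rewrite [symD _](symD_scale8 _ _ (traceP R + 3)); first by rewrite addrK.
  by rewrite symDE; exact: (orbit_sum_seedp8 _ _ _ _ aE bE).
- rewrite [symD _](symD_scale8 _ _ (traceQ R - 9)); first by rewrite subrK.
  by rewrite symDE; exact: (orbit_sum_seedq8 _ _ _ _ aE bE).
Qed.
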